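(* Let $\mathcal{X}_1,\dots,\mathcal{X}_n$ be separable complete metric spaces, let $\mathcal{X}=\prod_{i=1}^n\mathcal{X}_i$, and let $Q=\prod_{i=1}^nQ_i$ be a Borel probability measure on $\mathcal{X}$ of product form. Let $X=(X_1,\dots,X_n)\sim Q$, and for $S\subset\{1,\dots,n\}$ let $X_S=(X_i)_{i\in S}$ be the natural projection of $X$ onto $\mathcal{X}_S=\prod_{i\in S}\mathcal{X}_i$. Then for any collection $\mathcal{C}$ of distinct subsets of $\{1,\dots,n\}$ and any measurable $f:\mathcal{X}\to\mathbb{R}$ with $\mathbb{E}[f(X)^2]<\infty$, $$\sum_{S\in\mathcal{C}}\operatorname{Var}\big(\mathbb{E}[f(X)\mid X_S]\big)\le r\,\operatorname{Var}(f(X)),$$ where $r:=\max_{i\in\{1,\dots,n\}}\#\{S\in\mathcal{C}:i\in S\}$ and the (conditional) expectations and variances are with respect to $Q$.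
   Context: For $S=\emptyset$, $\mathbb{E}[f(X)\mid X_\emptyset]=\mathbb{E}[f(X)]$. *)

(* Defs.v *)
From HB Require Import structures.
From mathcomp Require Import all_boot all_order all_algebra.
From mathcomp Require Import all_classical all_reals all_analysis.

Set Implicit Arguments.
Unset Strict Implicit.
Unset Printing Implicit Defensive.

Import Order.TTheory GRing.Theory Num.Theory.
Import numFieldNormedType.Exports.

Local Open Scope classical_set_scope.
Local Open Scope ring_scope.

#[short(type="completeMetricType")]
HB.structure Definition CompleteMetric (K : numDomainType) :=
  {M of Metric K M & Complete M}.

Definition separable (T : topologicalType) : Prop :=
  exists2 D : set T, countable D & dense D.

(* The carrier T equipped with its Borel sigma-algebra. *)
Notation borel T := (g_sigma_algebraType (@open T)).

HB.instance Definition _ (I : Type) (E : I -> ptopologicalType) :=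
  Pointed.copy (prod_topology E) (forall i, E i).

Section product_space.
Context {R : realType} {n : nat}.
Implicit Types (E : 'I_n -> completeMetricType R) (S : {set 'I_n}).

Definition product_space E : ptopologicalType := prod_topology E.

(* For S empty this is a one-point space. *)
Definition subproduct_space E S : ptopologicalType :=
  prod_topology (fun i : {i : 'I_n | i \in S} => E (val i)).

Definition subproj E S (x : product_space E) : subproduct_space E S :=
  fun i => x (val i).

(* On these separable spaces the Borel rectangles form a pi-system generating
   the Borel sigma-algebra of the product, so this determines Q. *)
Definition is_product_measure E
    (Qi : forall i, probability (borel (E i)) R)
    (Q : probability (borel (product_space E)) R) : Prop :=
  forall A : forall i, set (E i),
    (forall i, measurable (A i : set (borel (E i)))) ->
    Q [set x | forall i, A i (x i)] = (\prod_(i < n) Qi i (A i))%E.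

End product_space.

(* g is a version of the conditional expectation E[Z | Y]; it is determined
   up to P-almost sure equality, and it is constant, equal to E[Z], when Y
   takes values in a one-point space. *)
Definition is_condexp d d' (Om : measurableType d) (T : measurableType d')
    (R : realType) (P : probability Om R) (Z : Om -> R) (Y : Om -> T)
    (g : Om -> R) : Prop :=
  [/\ measurable_fun [set: g_sigma_algebra_preimageType Y] g,
      P.-integrable setT (EFin \o g) &
      forall A : set Om, g_sigma_algebra_preimage Y A ->
        (\int[P]_(w in A) (g w)%:E = \int[P]_(w in A) (Z w)%:E)%E].

(* Main.v *)
Require Import Defs.
From HB Require Import structures.
From mathcomp Require Import all_boot all_order all_algebra.
From mathcomp Require Import all_classical all_reals all_analysis.
From mathcomp Require Import measurable_realfun ring lra.

(** Why the inequality holds. Write [m] for the mean of [f] and, for [S] in the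
    collection, [v S] for the conditional expectation of [f] given the
    coordinates in [S], minus [m]. Conditional expectation is an orthogonal
    projection in [L2], so [v S] has the same inner product with itself as with
    [f - m]. Hence the left side of the inequality is the inner product of
    [f - m] with the sum of the [v S], and by Cauchy-Schwarz it is enough to
    bound the squared norm of this sum by [r] times the sum of the squared norms
    of the [v S] ([sum_variance_averages_le]).

    This dual bound ([integral_sqr_sum_le]) holds for any centered functions
    [v S] of the coordinates in [S]. It is proved by averaging out the
    coordinates one after the other. For one coordinate [i], every squared norm
    splits by Pythagoras into that of the average over [i] and that of the
    fluctuation around this average. Only the at most [r] functions with [i] in
    [S] have a fluctuation, so the squared norm of the sum of the fluctuations
    costs at most a factor [r]. Once all coordinates are averaged out, only the
    means are left, and these vanish.

    Averaging over coordinate [i] is the integral over [y] of the function at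
    the point obtained from [x] by taking the [i]-th coordinate from [y]. The
    product form of the measure enters only through the fact that this
    replacement, applied to two independent points, preserves the law
    ([product_resampling]). Separability enters through the Borel sigma-algebra
    of the product being generated by boxes ([measurable_boxE]).

    Finally, averaging over the complement of [S] is a version of the conditional
    expectation given the coordinates in [S] ([averages_is_condexp]), and two
    versions agree almost everywhere ([is_condexp_ae_unique]), so they have the
    same variance. *)

Set Implicit Arguments.
Unset Strict Implicit.
Unset Printing Implicit Defensive.

Import Order.TTheory GRing.Theory Num.Theory.
Import numFieldNormedType.Exports.

Local Open Scope classical_set_scope.
Local Open Scope ring_scope.

(** * Square-integrable functions on a probability space *)

(** The difference of the two sides is half the double sum over [B] of the
    squares [(a j - a k) ^+ 2]. *)
Lemma sqr_sum_le (R : realType) (J : finType) (B : {set J}) (a : J -> R) :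
  (\sum_(j in B) a j) ^+ 2 <= #|B|%:R * \sum_(j in B) a j ^+ 2.
Proof.
have : 0 <= \sum_(j in B) \sum_(k in B) (a j - a k) ^+ 2.
  by apply: sumr_ge0 => j _; apply: sumr_ge0 => k _; exact: sqr_ge0.
have -> : \sum_(j in B) \sum_(k in B) (a j - a k) ^+ 2 =
   2 * (#|B|%:R * \sum_(j in B) a j ^+ 2 - (\sum_(j in B) a j) ^+ 2).
  transitivity (\sum_(j in B) (#|B|%:R * a j ^+ 2
      - 2 * (\sum_(k in B) a k) * a j + \sum_(k in B) a k ^+ 2)).
    apply: eq_bigr => j _; under eq_bigr do rewrite sqrrB.
    rewrite big_split sumrB /= sumr_const mulr_natl; congr (_ - _ + _).
    by rewrite mulr_sumr mulr_suml; apply: eq_bigr => k _; ring.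
  rewrite big_split sumrB /= sumr_const -!mulr_sumr -mulr_natl; ring.
by rewrite pmulr_rge0// subr_ge0.
Qed.

Section square_integrable.
Context d (T : measurableType d) (R : realType) (mu : probability T R).
Implicit Types u v : T -> R.

Lemma square_integrableP u : u \in Lfun mu 2%:E <->
  measurable_fun setT u /\ mu.-integrable setT (fun x => (u x ^+ 2)%:E).
Proof.
split=> [u2|[mv iu]].
  split; last exact: Lfun2_integrable_sqr.
  by move: u2; rewrite inE => /andP[/[!inE]].
rewrite inE; apply/andP; split; rewrite inE//=.
rewrite /finite_norm unlock /Lnorm poweR_lty//.
rewrite (eq_integral (fun x => (u x ^+ 2)%:E)); last first.
  by move=> x _; rewrite abse_EFin poweR_EFin powR_mulrn// real_normK// num_real.
exact: integrable_lty.
Qed.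

Lemma Lfun2_measurable u : u \in Lfun mu 2%:E -> measurable_fun setT u.
Proof. by case/square_integrableP. Qed.

Lemma Lfun2_integrable u : u \in Lfun mu 2%:E -> mu.-integrable setT (EFin \o u).
Proof.
by move/(Lfun_subset12 (fin_num_measure mu _ measurableT))/Lfun1_integrable.
Qed.

Lemma Lfun2_mul_integrable u v : u \in Lfun mu 2%:E -> v \in Lfun mu 2%:E ->
  mu.-integrable setT (fun x => (u x * v x)%:E).
Proof. by move=> u2 v2; have /Lfun1_integrable := Lfun2_mul_Lfun1 u2 v2. Qed.

Lemma Lfun2_add u v : u \in Lfun mu 2%:E -> v \in Lfun mu 2%:E ->
  (fun x => u x + v x) \in Lfun mu 2%:E.
Proof. by move=> u2 v2; exact: (Lfun_addr_closed mu (lee1n 2)).2 _ _ u2 v2. Qed.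

Lemma Lfun2_sub u v : u \in Lfun mu 2%:E -> v \in Lfun mu 2%:E ->
  (fun x => u x - v x) \in Lfun mu 2%:E.
Proof.
move=> u2 v2; apply: (@Lfun2_add u (fun x => - v x)) => //.
exact: (@Lfun_oppr_closed _ _ _ mu 2%:E v v2).
Qed.

Lemma Lfun2_sum (J : finType) (C : {set J}) (v : J -> T -> R) :
  (forall j, v j \in Lfun mu 2%:E) ->
  (fun x => \sum_(j in C) v j x) \in Lfun mu 2%:E.
Proof.
move=> v2; rewrite (_ : (fun x => _) = \sum_(j in C) v j); last first.
  by apply/funext => x; rewrite fct_sumE.
have [l0 lD] := @Lfun_addr_closed _ _ _ mu 2%:E (lee1n 2).
by elim/big_ind: _ => // f g; exact: lD.
Qed.

Lemma Rintegral_sum (J : finType) (C : {set J}) (v : J -> T -> R) :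
  (forall j, mu.-integrable setT (EFin \o v j)) ->
  \int[mu]_x (\sum_(j in C) v j x) = \sum_(j in C) \int[mu]_x v j x.
Proof.
move=> iv; rewrite /Rintegral; under eq_integral do rewrite -sumEFin.
rewrite integral_sum// -sum_fine// => j _.
by apply: integrable_fin_num => //; exact: iv.
Qed.

Lemma Rintegral_cst1 (c : R) : \int[mu]_(x in setT) c = c.
Proof.
rewrite Rintegral_cst// [X in fine X](_ : _ = 1%E) ?mulr1//.
exact: probability_setT.
Qed.

(** The integral hypothesis says that [v - w] is orthogonal to [w], so the cross
    term vanishes when [v = w + (v - w)] is squared. *)
Lemma pythagoras v w : v \in Lfun mu 2%:E -> w \in Lfun mu 2%:E ->
    \int[mu]_x (v x * w x) = \int[mu]_x (w x * w x) ->
  \int[mu]_x (v x ^+ 2) = \int[mu]_x (w x ^+ 2) + \int[mu]_x ((v x - w x) ^+ 2).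
Proof.
move=> v2 w2 vw.
have iww := Lfun2_mul_integrable w2 w2.
have ivw := Lfun2_mul_integrable v2 w2.
have ivv := Lfun2_mul_integrable v2 v2.
have i2vw : mu.-integrable setT (EFin \o (fun x => 2 * (v x * w x))).
  exact: (integrableZl measurableT 2 ivw).
have -> : \int[mu]_x ((v x - w x) ^+ 2) =
  \int[mu]_x (v x * v x - 2 * (v x * w x) + w x * w x).
  by apply: eq_Rintegral => x _; ring.
rewrite RintegralD//; last exact: (integrableB measurableT ivv i2vw).
rewrite RintegralB// RintegralZl// vw.
under eq_Rintegral do rewrite expr2.
under [X in _ = X + _]eq_Rintegral do rewrite expr2.
by move: (Rintegral _ _ _) (Rintegral _ _ _) => a b; ring.
Qed.

Lemma cauchy_schwarz v w : v \in Lfun mu 2%:E -> w \in Lfun mu 2%:E ->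
  (\int[mu]_x (v x * w x)) ^+ 2 <=
    \int[mu]_x (v x ^+ 2) * \int[mu]_x (w x ^+ 2).
Proof.
move=> v2 w2.
have iww := Lfun2_mul_integrable w2 w2.
have ivw := Lfun2_mul_integrable v2 w2.
have ivv := Lfun2_mul_integrable v2 v2.
set a := \int[mu]_x (v x ^+ 2); set b := \int[mu]_x (v x * w x).
set c := \int[mu]_x (w x ^+ 2).
(* the integral of the square of [s v - t w] is a nonnegative quadratic form
   in [(s, t)]; its values at [(b, a)] and [(c, b)] give the bound unless
   [a = c = 0], where the value at [(b, 1)] forces [b = 0] *)
have quad s t : 0 <= s ^+ 2 * a - 2 * s * t * b + t ^+ 2 * c.
  have := @Rintegral_ge0 _ _ _ mu setT (fun x => (s * v x - t * w x) ^+ 2)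
    (fun x _ => sqr_ge0 _).
  have isa : mu.-integrable setT (EFin \o (fun x => s ^+ 2 * (v x * v x))).
    exact: (integrableZl measurableT _ ivv).
  have isb : mu.-integrable setT (EFin \o (fun x => 2 * s * t * (v x * w x))).
    exact: (integrableZl measurableT _ ivw).
  have isc : mu.-integrable setT (EFin \o (fun x => t ^+ 2 * (w x * w x))).
    exact: (integrableZl measurableT _ iww).
  have -> : \int[mu]_x ((s * v x - t * w x) ^+ 2) = \int[mu]_x
     (s ^+ 2 * (v x * v x) - 2 * s * t * (v x * w x) + t ^+ 2 * (w x * w x)).
    by apply: eq_Rintegral => x _; ring.
  rewrite RintegralD//; last exact: (integrableB measurableT isa isb).
  by rewrite RintegralB// !RintegralZl.
have a0 : 0 <= a by apply: Rintegral_ge0 => x _; exact: sqr_ge0.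
have c0 : 0 <= c by apply: Rintegral_ge0 => x _; exact: sqr_ge0.
have qa : 0 <= a * (a * c - b ^+ 2) by have := quad b a; nra.
have qc : 0 <= c * (a * c - b ^+ 2) by have := quad c b; nra.
rewrite -subr_ge0; move: a0 c0; rewrite !le_eqVlt => /predU1P[a0|a_gt0].
  move=> /predU1P[c0|c_gt0]; last by rewrite -le_eqVlt -(pmulr_rge0 _ c_gt0).
  by have := quad b 1; rewrite -le_eqVlt -a0 -c0; nra.
by move=> _; rewrite -le_eqVlt -(pmulr_rge0 _ a_gt0).
Qed.

End square_integrable.

(** * Averaging over one coordinate *)

Section resampling.
Context d (T : measurableType d) (R : realType) (mu : probability T R).
Context (K : eqType) (phi : K -> T * T -> T).

(** This is how independence of the [i]-th coordinate is expressed when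
    [phi i (x, y)] is [x] with its [i]-th coordinate taken from [y]. It holds
    pointwise and not only almost everywhere, which keeps it stable under
    averaging. *)
Definition ignores (i : K) (v : T -> R) := forall x y, v (phi i (x, y)) = v x.

(** What the argument uses of a product measure: replacing one coordinate of a
    random point by that of an independent copy does not change its law, and
    replacements of coordinates compose as expected. The last field is what
    makes a function constant once every coordinate has been averaged out. *)
Record resampling : Prop := Resampling {
  resampling_measurable : forall i, measurable_fun setT (phi i);
  resampling_invariant : forall i (A : set T), measurable A ->
    (mu \x mu)%E (phi i @^-1` A) = mu A;
  resampling_idem : forall i x y z, phi i (phi i (x, y), z) = phi i (x, z);
  resampling_comm : forall i j, i != j -> forall x y z,
    phi i (phi j (x, y), z) = phi j (phi i (x, z), y);
  resampling_total : forall v : T -> R, (forall i, ignores i v) ->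
    forall x y, v x = v y }.

(** A pointwise defined version of the conditional expectation of [v] given all
    coordinates but the [i]-th one. Its value is arbitrary on the null set where
    the integral does not make sense. *)
Definition average (i : K) (v : T -> R) (x : T) : R :=
  \int[mu]_y v (phi i (x, y)).

Lemma average_id i v : ignores i v -> average i v = v.
Proof.
move=> iv; apply/funext => x; rewrite /average.
under eq_Rintegral do rewrite iv.
exact: Rintegral_cst1.
Qed.

Context (rs : resampling).
Let mphi := resampling_measurable rs.

Lemma ignores_average i v : ignores i (average i v).
Proof.
by move=> x y; apply: eq_Rintegral => z _; rewrite (resampling_idem rs).
Qed.

Lemma ignores_averageW i j v : ignores j v -> ignores j (average i v).
Proof.
have [->|ij] := eqVneq i j; first by move=> _; exact: ignores_average.
move=> jv x y; apply: eq_Rintegral => z _.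
by rewrite (resampling_comm rs)// jv.
Qed.

Lemma ignores_sum (J : finType) (C : {set J}) i (v : J -> T -> R) :
  (forall j, ignores i (v j)) -> ignores i (fun x => \sum_(j in C) v j x).
Proof. by move=> iv x y; apply: eq_bigr => j _; exact: iv. Qed.

Lemma integral_resampling i (g : T -> \bar R) :
  measurable_fun [set: T] g -> (forall x, 0 <= g x)%E ->
  (\int[mu \x mu]_z g (phi i z) = \int[mu]_x g x)%E.
Proof.
move=> mg g0.
rewrite -(ge0_integral_pushforward (mphi i) (mu \x mu)%E (D := setT))//.
by apply: eq_measure_integral => A mA _; exact: (resampling_invariant rs).
Qed.

Lemma integrable_resampling i v : mu.-integrable setT (EFin \o v) ->
  (mu \x mu)%E.-integrable setT (fun z => (v (phi i z))%:E).
Proof.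
move=> /integrableP[mv iv]; apply/integrableP; split.
  exact: (measurableT_comp mv (mphi i)).
rewrite (@integral_resampling i (fun x => `|(v x)%:E|%E))//.
exact: measurableT_comp.
Qed.

Lemma ae_integrable_resampling i v : mu.-integrable setT (EFin \o v) ->
  {ae mu, forall x, mu.-integrable setT (fun y => (v (phi i (x, y)))%:E)}.
Proof. by move/(integrable_resampling i)/ae_integrable1. Qed.

Lemma average_ae i v : mu.-integrable setT (EFin \o v) ->
  ae_eq mu setT (fubini_F mu (fun z => (v (phi i z))%:E)) (EFin \o average i v).
Proof.
move=> iv; have := ae_integrable_resampling i iv; apply: filterS => x ivx _.
by rewrite /average /Rintegral /= fineK//; exact: integrable_fin_num.
Qed.

Lemma measurable_average i v : mu.-integrable setT (EFin \o v) ->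
  measurable_fun setT (average i v).
Proof.
move=> /(integrable_resampling i) iv.
apply: (measurableT_comp (f := fine)) => //.
exact: (measurable_fubini_F iv).
Qed.

Lemma integrable_average i v : mu.-integrable setT (EFin \o v) ->
  mu.-integrable setT (EFin \o average i v).
Proof.
move=> iv; have iv2 := integrable_resampling i iv.
have mav := measurable_average i iv.
have [mF iF] := integrableP _ _ _ (integrable_fubini_F iv2).
apply/integrableP; split; first exact/measurable_EFinP.
apply: le_lt_trans iF; rewrite le_eqVlt; apply/orP; left; apply/eqP.
apply: ae_eq_integral => //.
- by apply: measurableT_comp => //; exact/measurable_EFinP.
- exact: measurableT_comp.
by have := average_ae i iv; apply: filterS => x /(_ I) /= ->.
Qed.

(** By Fubini the left side is the integral of [v (phi i (x, y))] over
    independent [x] and [y], and [phi i] preserves the law. *)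
Lemma integral_average i v : mu.-integrable setT (EFin \o v) ->
  \int[mu]_x average i v x = \int[mu]_x v x.
Proof.
move=> iv; have iv2 := integrable_resampling i iv.
have [mv _] := integrableP _ _ _ iv.
rewrite /Rintegral; congr fine.
transitivity (\int[mu]_x fubini_F mu (fun z => (v (phi i z))%:E) x)%E.
  apply: ae_eq_integral => //.
  - by apply/measurable_EFinP; exact: measurable_average.
  - exact: (measurable_fubini_F iv2).
  - exact/ae_eq_sym/average_ae.
rewrite (integral12_prod_meas1 iv2).
rewrite -[LHS](@integral_pushforward _ _ _ _ _ _ (mphi i) _ setT _ mv)//.
by apply: eq_measure_integral => A mA _; exact: (resampling_invariant rs).
Qed.

(** Jensen: wherever [v] and [v ^+ 2] are integrable in the resampled variable,
    its variance is nonnegative, so the square of the average is at most the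
    average of the square, which is integrable. *)
Lemma Lfun2_average i v : v \in Lfun mu 2%:E -> average i v \in Lfun mu 2%:E.
Proof.
move=> v2; have iv := Lfun2_integrable v2.
have iv2 : mu.-integrable setT (EFin \o (fun x => v x ^+ 2)).
  exact: Lfun2_integrable_sqr.
have mav := measurable_average i iv.
apply/square_integrableP; split => //.
apply/integrableP; split.
  by apply/measurable_EFinP; exact: measurable_funX.
apply: le_lt_trans (integrable_lty measurableT (integrable_average i iv2)).
apply: ae_ge0_le_integral => //.
- by apply/measurable_EFinP/measurableT_comp => //; exact: measurable_funX.
- by move=> x _; rewrite lee_fin; apply: Rintegral_ge0 => y _; exact: sqr_ge0.
- by apply/measurable_EFinP; exact: measurable_average.
have := ae_integrable_resampling i iv.
apply: filterS2 (ae_integrable_resampling i iv2).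
move=> x iv2x ivx _; rewrite /= ger0_norm ?sqr_ge0// lee_fin.
pose c := average i v x.
have icst : mu.-integrable setT (EFin \o cst (c ^+ 2)).
  exact: finite_measure_integrable_cst.
have icv : mu.-integrable setT (EFin \o (fun y => 2 * c * v (phi i (x, y)))).
  exact: (integrableZl measurableT (2 * c) ivx).
have : 0 <= \int[mu]_y (v (phi i (x, y)) - c) ^+ 2.
  by apply: Rintegral_ge0 => y _; exact: sqr_ge0.
under eq_Rintegral do rewrite sqrrB -mulr_natl (mulrC _ c) mulrA.
rewrite RintegralD//; last exact: (integrableB measurableT iv2x icv).
rewrite RintegralB// RintegralZl// Rintegral_cst1.
rewrite -/(average i v x) -/c -/(average i (fun x => v x ^+ 2) x) -mulrA -expr2.
by rewrite /average; lra.
Qed.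

(** Averaging is an orthogonal projection in [L2]: a factor [w] that ignores
    coordinate [i] is a constant in the averaged variable, so averaging [v * w]
    amounts to averaging [v]. *)
Lemma averageM i v w : v \in Lfun mu 2%:E -> w \in Lfun mu 2%:E -> ignores i w ->
  \int[mu]_x (average i v x * w x) = \int[mu]_x (v x * w x).
Proof.
move=> v2 w2 iw; have iv := Lfun2_integrable v2.
have ivw := Lfun2_mul_integrable v2 w2.
rewrite -(integral_average i ivw) /Rintegral; congr fine.
apply: ae_eq_integral => //.
- apply/measurable_EFinP/measurable_funM; last exact: Lfun2_measurable w2.
  exact: measurable_average.
- by apply/measurable_EFinP; exact: measurable_average.
have := ae_integrable_resampling i iv; apply: filterS => x ivx _.
rewrite /average /=; congr EFin; rewrite -RintegralZr//.
by apply: eq_Rintegral => y _; rewrite iw.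
Qed.

End resampling.

(** * Functions of subsets of the coordinates *)

Section subset_families.
Context d (T : measurableType d) (R : realType) (mu : probability T R).
Context (K : eqType) (phi : K -> T * T -> T).
Context (rs : resampling mu phi).

Lemma integral_sum_averageM i (J : finType) (C : {set J}) (v : J -> T -> R) u :
    (forall j, v j \in Lfun mu 2%:E) -> u \in Lfun mu 2%:E -> ignores phi i u ->
  \int[mu]_x ((\sum_(j in C) v j x) * u x) =
  \int[mu]_x ((\sum_(j in C) average mu phi i (v j) x) * u x).
Proof.
move=> v2 u2 iu; under eq_Rintegral do rewrite mulr_suml.
under [RHS]eq_Rintegral do rewrite mulr_suml.
rewrite !Rintegral_sum//.
- by apply: eq_bigr => j _; rewrite (averageM rs).
- by move=> j; apply: Lfun2_mul_integrable => //; exact: Lfun2_average.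
- by move=> j; exact: Lfun2_mul_integrable.
Qed.

(** The inequality in dual form, for arbitrary centered functions [v j] of the
    coordinates in [A j]. The list [s] contains the coordinates not yet
    averaged out. Averaging over its head [i] splits each squared norm, by
    Pythagoras, into the norm of the average, handled by induction, and that of
    the fluctuation [v j - average i (v j)]. The fluctuation vanishes unless
    [i] belongs to [A j], so at most [r] terms survive in the sum of the
    fluctuations, and the square of a sum of at most [r] numbers is at most [r]
    times the sum of their squares. *)
Lemma integral_sqr_sum_le (J : finType) (C : {set J}) (A : J -> pred K) (r : nat)
    (s : seq K) (v : J -> T -> R) :
    (forall i, (#|[set j in C | A j i]| <= r)%N) ->
    (forall j, v j \in Lfun mu 2%:E) ->
    (forall j, \int[mu]_x v j x = 0) ->
    (forall j i, ~~ A j i || (i \notin s) -> ignores phi i (v j)) ->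
  \int[mu]_x ((\sum_(j in C) v j x) ^+ 2) <=
    r%:R * \sum_(j in C) \int[mu]_x (v j x ^+ 2).
Proof.
move=> Cr; elim: s v => [|i s IH] v v2 v0 iv.
  (* nothing is left to average: [v j] is constant, equal to its mean [0] *)
  have v00 j x : v j x = 0.
    rewrite -(v0 j) -[LHS](@Rintegral_cst1 _ _ _ mu); apply: eq_Rintegral => y _.
    by apply: (resampling_total rs) => i; apply: iv; rewrite orbT.
  under eq_Rintegral do rewrite big1 ?expr0n//=.
  rewrite Rintegral_cst1 mulr_ge0// sumr_ge0// => j _.
  by apply: Rintegral_ge0 => x _; exact: sqr_ge0.
pose w j := average mu phi i (v j).
have w2 j : w j \in Lfun mu 2%:E by exact: Lfun2_average.
have iw j : ignores phi i (w j) by exact: ignores_average.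
have sv2 := Lfun2_sum C v2.
have sw2 := Lfun2_sum C w2.
rewrite (pythagoras sv2 sw2); last first.
  by apply: integral_sum_averageM => //; exact: ignores_sum.
have pyth j : \int[mu]_x (v j x ^+ 2) =
    \int[mu]_x (w j x ^+ 2) + \int[mu]_x ((v j x - w j x) ^+ 2).
  by apply: pythagoras => //; rewrite (averageM rs).
under [in leRHS]eq_bigr do rewrite pyth.
rewrite big_split mulrDr lerD//=.
  apply: IH => // j; first by rewrite (integral_average rs)// Lfun2_integrable.
  move=> k; have [->//|ki] := eqVneq k i.
  by move=> kj; apply: (ignores_averageW rs); apply: iv; rewrite inE negb_or ki.
pose B := [set j in C | A j i].
have Br : (#|B| <= r)%N := Cr i.
have D2 j : (fun x => v j x - w j x) \in Lfun mu 2%:E by exact: Lfun2_sub.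
have iD j : mu.-integrable setT (EFin \o (fun x => (v j x - w j x) ^+ 2)).
  by have [_] := (square_integrableP _ _).1 (D2 j).
have vw x : \sum_(j in C) v j x - \sum_(j in C) w j x =
    \sum_(j in B) (v j x - w j x).
  rewrite -sumrB big_mkcond [RHS]big_mkcond; apply: eq_bigr => j _.
  rewrite inE; case: ifP => //= jC; case: ifP => // /negbT jA.
  by rewrite /w average_id ?subrr//; apply: iv; rewrite jA.
have iB : mu.-integrable setT
    (EFin \o (fun x => \sum_(j in B) (v j x - w j x) ^+ 2)).
  have := @integrable_sum _ _ _ mu setT measurableT _ (index_enum J) (mem B)
    (fun j x => ((v j x - w j x) ^+ 2)%:E) (fun j _ => iD j).
  by apply: eq_integrable => // x _; rewrite sumEFin.
apply: (@le_trans _ _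
    (\int[mu]_x (r%:R * \sum_(j in B) (v j x - w j x) ^+ 2))).
  apply: le_Rintegral => //.
  - by have [_] := (square_integrableP _ _).1 (Lfun2_sub sv2 sw2).
  - exact: (integrableZl measurableT _ iB).
  move=> x _; rewrite vw; apply: le_trans (sqr_sum_le _ _) _.
  by rewrite ler_wpM2r ?ler_nat ?sumr_ge0// => j _; exact: sqr_ge0.
rewrite RintegralZl// Rintegral_sum// ler_wpM2l//.
rewrite big_mkcond [leRHS]big_mkcond ler_sum// => j _.
rewrite inE; case: (j \in C) => //=; case: ifP => // _.
by apply: Rintegral_ge0 => x _; exact: sqr_ge0.
Qed.

(** A version of the conditional expectation of [v] given the coordinates
    outside [s]. *)
Definition averages (s : seq K) (v : T -> R) := foldr (average mu phi) v s.

Lemma Lfun2_averages s v : v \in Lfun mu 2%:E -> averages s v \in Lfun mu 2%:E.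
Proof. by move=> v2; elim: s => //= i s IH; exact: Lfun2_average. Qed.

Lemma ignores_averages s i v : i \in s -> ignores phi i (averages s v).
Proof.
elim: s => //= j s IH; rewrite inE => /orP[/eqP ->|/IH].
  exact: ignores_average.
exact: ignores_averageW.
Qed.

Lemma averagesM s v w : v \in Lfun mu 2%:E -> w \in Lfun mu 2%:E ->
    (forall i, i \in s -> ignores phi i w) ->
  \int[mu]_x (averages s v x * w x) = \int[mu]_x (v x * w x).
Proof.
move=> v2 w2; elim: s => //= i s IH iw; rewrite (averageM rs)//.
- by apply: IH => j js; apply: iw; rewrite inE js orbT.
- exact: Lfun2_averages.
- by apply: iw; rewrite inE eqxx.
Qed.

Lemma integral_averages s v : v \in Lfun mu 2%:E ->
  \int[mu]_x averages s v x = \int[mu]_x v x.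
Proof.
move=> v2; elim: s => //= i s IH; rewrite (integral_average rs)//.
by apply: Lfun2_integrable; exact: Lfun2_averages.
Qed.

End subset_families.

Section subset_inequality.
Context d (T : measurableType d) (R : realType) (mu : probability T R).
Context (K : finType) (phi : K -> T * T -> T).
Context (rs : resampling mu phi).

(** The main inequality, with the conditional expectations given [S] realized by
    averaging over the complement of [S]. Put [v S] for such an average minus
    [m]. Since averaging is an orthogonal projection, the sum of the squared
    norms of the [v S] is the inner product of [f - m] with the sum of the
    [v S]. Cauchy-Schwarz and the dual form bound the square of this inner
    product by the squared norm of [f - m] times [r] times the same sum of
    squared norms, and one factor cancels. *)
Lemma sum_variance_averages_le (C : {set {set K}}) (r : nat) (f : T -> R)
    (m := \int[mu]_x f x) :
    (forall i, (#|[set S in C | i \in S]| <= r)%N) -> f \in Lfun mu 2%:E ->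
  \sum_(S in C) \int[mu]_x ((averages mu phi (enum (~: S)) f x - m) ^+ 2) <=
    r%:R * \int[mu]_x ((f x - m) ^+ 2).
Proof.
move=> Cr f2; pose w S := averages mu phi (enum (~: S)) f.
pose v S x := w S x - m.
have m2 : cst m \in Lfun mu 2%:E by exact: Lfun_cst.
have w2 S : w S \in Lfun mu 2%:E by exact: Lfun2_averages.
have v2 S : v S \in Lfun mu 2%:E by exact: Lfun2_sub.
have fm2 : (fun x => f x - m) \in Lfun mu 2%:E by exact: Lfun2_sub.
have i0 S : \int[mu]_x v S x = 0.
  rewrite RintegralB ?Rintegral_cst1 ?(integral_averages rs) ?subrr//;
    by [exact: Lfun2_integrable|exact: Lfun2_integrable m2].
have ig (S : {set K}) i : i \notin S -> ignores phi i (v S).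
  move=> iS x y; congr (_ - _); apply: ignores_averages => //.
  by rewrite mem_enum inE.
(* [v S] is centered and is the projection of [f - m] *)
have key S : \int[mu]_x (v S x ^+ 2) = \int[mu]_x ((f x - m) * v S x).
  have imv : mu.-integrable setT (EFin \o (fun x => m * v S x)).
    exact: (integrableZl measurableT _ (Lfun2_integrable (v2 S))).
  have -> : \int[mu]_x (v S x ^+ 2) = \int[mu]_x (w S x * v S x - m * v S x).
    by apply: eq_Rintegral => x _; rewrite /v; ring.
  have -> : \int[mu]_x ((f x - m) * v S x) = \int[mu]_x (f x * v S x - m * v S x).
    by apply: eq_Rintegral => x _; rewrite /v; ring.
  rewrite !RintegralB//; try exact: Lfun2_mul_integrable.
  congr (_ - _); apply: averagesM => // i; rewrite mem_enum inE; exact: ig.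
set a := \sum_(S in C) _; set V := \int[mu]_x _.
have aE : a = \int[mu]_x ((f x - m) * \sum_(S in C) v S x).
  under eq_Rintegral do rewrite mulr_sumr.
  rewrite Rintegral_sum; last by move=> S; exact: Lfun2_mul_integrable.
  by apply: eq_bigr => S _; exact: key.
have := cauchy_schwarz fm2 (Lfun2_sum C v2); rewrite -aE -/V.
have := @integral_sqr_sum_le _ _ _ _ _ _ rs _ C
  (fun (S : {set K}) i => i \in S) r (enum K) v.
move=> /(_ Cr v2 i0) /=; rewrite -/a.
have a0 : 0 <= a.
  by apply: sumr_ge0 => S _; apply: Rintegral_ge0 => x _; exact: sqr_ge0.
have V0 : 0 <= V by apply: Rintegral_ge0 => x _; exact: sqr_ge0.
move=> H aV; have {}H := H _; have {}aV := le_trans aV (ler_wpM2l V0 (H _)).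
move: a0; rewrite le_eqVlt => /predU1P[<-|a_gt0]; first by rewrite mulr_ge0.
rewrite -(ler_pM2r a_gt0) -expr2 (le_trans (aV _))//; last lra.
by move=> S i; rewrite mem_enum orbF; exact: ig.
Qed.

End subset_inequality.

(** * Borel sets of a finite product *)

(** The base consists of the balls of radii [1 / (k + 1)] around the points of
    the dense set. Their interiors are taken because balls need not be open
    in a pseudometric structure. *)
Lemma separable_second_countable (R : realType) (M : pseudoMetricType R) :
  separable M -> @second_countable M.
Proof.
move=> [D cD dD]; pose r (k : nat) : R := k.+1%:R^-1.
have r0 k : 0 < r k by rewrite invr_gt0.
pose B := \bigcup_k [set (ball x (r k))° | x in D].
exists B.
  by apply: bigcup_countable => // k _; exact: card_le_trans (card_image_le _ _) cD.
split=> [_ [k _ [x _ <-]]|x U /nbhs_ballP[e /= e0 eU]]; first exact: open_interior.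
have [k ke] : exists k, r k < e / 2.
  have [k] := ltr_add_invr (divr_gt0 e0 (ltr0n R 2)).
  by rewrite add0r => ?; exists k.
have [y [xy Dy]] : (ball x (r k / 2))° `&` D !=set0.
  apply: dD; last exact: open_interior.
  by exists x; apply: nbhsx_ballx; rewrite divr_gt0.
exists (ball y (r k))°.
  split; first by exists k => //; exists y.
  apply/nbhs_ballP; exists (r k / 2) => /=; first by rewrite divr_gt0.
  move=> z xz; rewrite [r k]splitr; apply: ball_triangle xz.
  exact: ball_sym (interior_subset xy).
move=> z /interior_subset yz; apply: eU; rewrite [e]splitr.
apply: (@ball_triangle _ _ y).
  apply: (@le_ball _ _ _ (r k / 2)); last exact: interior_subset.
  by rewrite ler_pdivrMr// (le_trans (ltW ke))// ler_peMr ?ler1n// divr_ge0// ltW.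
exact: (le_ball (ltW ke)).
Qed.

(** The natural numbers index the base, so that the choice of one base set in
    each of finitely many factors ranges over a countable type. *)
Lemma second_countable_enum (M : topologicalType) : @second_countable M ->
  exists e : nat -> set M, (forall k, open (e k)) /\
    forall x V, nbhs x V -> exists2 k, e k x & e k `<=` V.
Proof.
move=> [B /countable_injP[g g_inj] [Bo Bx]].
pose e k := xget setT [set V | B V /\ g V = k].
exists e; split.
  move=> k; rewrite /e; case: xgetP => [V _ [/Bo]//|_]; exact: openT.
move=> x V /(Bx x)[W [BW Wx] WV]; exists (g W).
  rewrite /e; case: xgetP => [W' _ [BW' gW']|/(_ W)[]//].
  by rewrite (g_inj W' W) ?inE.
rewrite /e; case: xgetP => [W' _ [BW' gW']|/(_ W)[]//].
by rewrite (g_inj W' W) ?inE.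
Qed.

(** The sets containing a box of neighbourhoods of the [x i] form a filter, and
    this filter converges to [x] for each of the initial topologies whose
    supremum is the product topology. When [I] is infinite the box need not be
    a neighbourhood of [x]. *)
Lemma nbhs_prod_box (I : eqType) (E : I -> topologicalType) (x : prod_topology E)
    (U : set (prod_topology E)) : nbhs x U ->
  exists2 V : forall i, set (E i), (forall i, nbhs (x i) (V i)) &
    [set y : prod_topology E | forall i, V i (y i)] `<=` U.
Proof.
pose F : set_system (prod_topology E) := [set U | exists2 V : forall i, set (E i),
  (forall i, nbhs (x i) (V i)) & [set y | forall i, V i (y i)] `<=` U].
have FF : Filter F.
  split.
  - by exists (fun i => setT) => // i; exact: filterT.
  - move=> A B [V xV VA] [W xW WB]; exists (fun i => V i `&` W i).
      by move=> i; exact: filterI.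
    by move=> y VWy; split; [apply: VA|apply: WB] => i; have [] := VWy i.
  - by move=> A B AB [V xV VA]; exists V => //; exact: subset_trans AB.
suff : F --> x by move=> /(_ U).
apply/cvg_sup => i A /= [_ [[B oB <-] Bx BA]].
exists (dfwith (fun j => [set: E j]) i B).
  move=> j; case: dfwithP => [|{}j _]; last exact: filterT.
  exact: open_nbhs_nbhs.
by move=> y /(_ i); rewrite dfwithin => By; apply: BA.
Qed.

Lemma measurable_fun_borel (d : measure_display) (X : measurableType d)
    (M : ptopologicalType) (f : X -> borel M) :
  (forall U : set M, open U -> measurable (f @^-1` U)) -> measurable_fun setT f.
Proof.
move=> mf; have bE : @measurable _ (borel M) = <<s @open M >> by [].
by apply: (measurability _ bE) => // _ [U oU <-]; rewrite setTI; exact: mf.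
Qed.

Lemma measurable_coordinate (I : eqType) (E : I -> ptopologicalType) (i : I) :
  measurable_fun setT
    (fun x : borel (prod_topology E : ptopologicalType) => x i : borel (E i)).
Proof.
apply: measurable_fun_borel => B oB; apply: sub_sigma_algebra.
exact: ((@continuousP (prod_topology E) (E i) (proj i)).1
  (@proj_continuous _ E i)).
Qed.

(** Where separability matters: an open set of the product is a countable union
    of boxes of base sets, so its preimage is a countable union of finite
    intersections of preimages of open sets of the factors. *)
Lemma measurable_fun_prod_topology (I : finType) (E : I -> ptopologicalType)
    (d : measure_display) (X : measurableType d)
    (f : X -> borel (prod_topology E : ptopologicalType)) :
    (forall i, @second_countable (E i)) ->
    (forall i, measurable_fun setT (fun x => f x i : borel (E i))) ->
  measurable_fun setT f.
Proof.
move=> sE mf.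
apply: measurable_fun_borel => U oU.
have {}sE i := cid (second_countable_enum (sE i)).
pose e i := projT1 (sE i); have eP i := projT2 (sE i).
pose box (k : {ffun I -> nat}) :=
  [set y : prod_topology E | forall i, e i (k i) (y i)].
have -> : f @^-1` U = \bigcup_(k in [set k | box k `<=` U]) (f @^-1` (box k)).
  apply/seteqP; split=> [x Ux|x [k kU xk]]; last exact: kU.
  have [V fV VU] := nbhs_prod_box (open_nbhs_nbhs (conj oU Ux)).
  have {}fV i : exists k, e i k (f x i) /\ e i k `<=` V i.
    by have [k ? ?] := (eP i).2 _ _ (fV i); exists k.
  pose k i := projT1 (cid (fV i)); have kP i := projT2 (cid (fV i)).
  exists (finfun k) => /=; last by move=> i; rewrite ffunE; exact: (kP i).1.
  apply: subset_trans VU => y yk i; apply: (kP i).2.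
  by have := yk i; rewrite ffunE.
rewrite bigcup_mkcond; apply: countable_bigcupT_measurable => // k.
case: ifP => // _; have -> : f @^-1` box k =
    \bigcap_(i in [set: I]) (fun x => f x i) @^-1` (e i (k i)).
  by apply/seteqP; split=> x /= h i; [move=> _|]; exact: h.
apply: fin_bigcap_measurable => // i _.
rewrite -[X in measurable X]setTI; apply: mf => //.
by apply: sub_sigma_algebra; exact: (eP i).1.
Qed.

(** * Replacing a coordinate under a product measure *)

Section product_resampling.
Context {R : realType} {n : nat} (E : 'I_n -> completeMetricType R).
Context (sepE : forall i, separable (E i)).
Local Notation T := (borel (product_space E)).

Definition replace_coordinate (i : 'I_n) (z : T * T) : T :=
  fun j => if j == i then z.2 j else z.1 j.

Definition measurable_box : set (set T) :=
  [set B | exists2 A : forall i, set (E i),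
    (forall i, measurable (A i : set (borel (E i)))) &
    B = [set x | forall i, A i (x i)]].

Lemma measurable_fun_product_space (d : measure_display) (X : measurableType d)
    (f : X -> T) :
    (forall i, measurable_fun setT (fun x => f x i : borel (E i))) ->
  measurable_fun setT f.
Proof.
apply: (@measurable_fun_prod_topology _ (fun i => E i)) => i.
exact: (separable_second_countable (sepE i)).
Qed.

Lemma measurable_product_coordinate (i : 'I_n) :
  measurable_fun setT (fun x : T => x i : borel (E i)).
Proof. exact: (@measurable_coordinate _ (fun i => E i) i). Qed.

Lemma measurable_box_measurable (B : set T) : measurable_box B -> measurable B.
Proof.
move=> [A mA ->].
have -> : [set x : T | forall i, A i (x i)] =
    \bigcap_(i in [set: 'I_n]) (fun x : T => x i) @^-1` A i.
  by apply/seteqP; split=> x h i; [move=> _|]; exact: h.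
apply: fin_bigcap_measurable => // i _.
by rewrite -[X in measurable X]setTI; apply: measurable_product_coordinate.
Qed.

Lemma measurable_boxI : setI_closed measurable_box.
Proof.
move=> _ _ [A mA ->] [B mB ->]; exists (fun i => A i `&` B i).
  by move=> i; exact: measurableI.
by apply/seteqP; split=> x => [[a b] i|h]; [|split=> i; have [] := h i].
Qed.

Lemma measurable_boxT : measurable_box setT.
Proof. by exists (fun i => setT) => //; apply/seteqP; split. Qed.

(** For the inclusion from left to right, the identity map from the space with
    the sigma-algebra generated by boxes to the Borel space is measurable because
    its coordinates are. *)
Lemma measurable_boxE : @measurable _ T = <<s measurable_box >>.
Proof.
apply/seteqP; split=> B mB.
  have mid : measurable_fun setT (id : g_sigma_algebraType measurable_box -> T).
    apply: measurable_fun_product_space => i _ A mA; rewrite setTI.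
    apply: sub_sigma_algebra; exists (dfwith (fun j => [set: E j]) i A).
      by move=> j; case: dfwithP.
    apply/seteqP; split=> x /= h; last by have := h i; rewrite dfwithin.
    by move=> j; case: dfwithP.
  by have := mid measurableT _ mB; rewrite setTI.
apply: smallest_sub mB; first exact: sigma_algebra_measurable.
exact: measurable_box_measurable.
Qed.

Lemma measurable_replace_coordinate i :
  measurable_fun setT (replace_coordinate i).
Proof.
apply: measurable_fun_product_space => j; rewrite /replace_coordinate.
have [_|_] := eqVneq j i.
  exact: (measurableT_comp (@measurable_product_coordinate j) measurable_snd).
exact: (measurableT_comp (@measurable_product_coordinate j) measurable_fst).
Qed.

Context (Qi : forall i, probability (borel (E i)) R) (Q : probability T R).
Context (prodQ : is_product_measure Qi Q).

(** The preimage of a box under the replacement is the product of two boxes: the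
    given one with its [i]-th side removed, and the one with only this side
    left. *)
Lemma replace_coordinate_box i (A : forall j, set (E j)) :
    (forall j, measurable (A j : set (borel (E j)))) ->
  (Q \x Q)%E (replace_coordinate i @^-1` [set x | forall j, A j (x j)]) =
    Q [set x | forall j, A j (x j)].
Proof.
move=> mA; pose A1 : forall j : 'I_n, set (E j) := dfwith A i setT.
pose A2 : forall j : 'I_n, set (E j) := dfwith (fun j => [set: E j]) i (A i).
have mA1 j : measurable (A1 j : set (borel (E j))) by rewrite /A1; case: dfwithP.
have mA2 j : measurable (A2 j : set (borel (E j))) by rewrite /A2; case: dfwithP.
have -> : replace_coordinate i @^-1` [set x | forall j, A j (x j)] =
    [set x : T | forall j : 'I_n, A1 j (x j)] `*`
    [set x : T | forall j : 'I_n, A2 j (x j)].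
  apply/seteqP; split=> [[x y] h|[x y] [/= h1 h2] j].
    split=> j /=.
      rewrite /A1; case: dfwithP => // k ik; have := h k.
      by rewrite /replace_coordinate eq_sym (negbTE ik).
    rewrite /A2; case: dfwithP => //; have := h i.
    by rewrite /replace_coordinate eqxx.
  rewrite /replace_coordinate /=; case: eqVneq => [->|ji].
    by have := h2 i; rewrite /A2 dfwithin.
  by have := h1 j; rewrite /A1 dfwithout// eq_sym.
have mbox B : (forall j, measurable (B j : set (borel (E j)))) ->
    measurable [set x : T | forall j : 'I_n, B j (x j)].
  by move=> mB; apply: measurable_box_measurable; exists B.
rewrite [LHS]product_measure1E; [|exact: mbox..].
transitivity (\prod_(j < n) Qi j (A1 j) * \prod_(j < n) Qi j (A2 j))%E.
  by congr (_ * _)%E; exact: prodQ.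
rewrite (prodQ mA) !(bigD1 (P := xpredT) i)//= /A1 /A2 !dfwithin.
rewrite probability_setT mul1e.
rewrite [X in (_ * (_ * X))%E]big1 ?mule1; last first.
  by move=> j ji; rewrite dfwithout 1?eq_sym// probability_setT.
rewrite muleC; congr (_ * _)%E.
by apply: eq_bigr => j ji; rewrite dfwithout 1?eq_sym.
Qed.

(** Replacing the coordinates of [x] in [s] by those of [y], one at a time, turns
    [x] into [y] and does not change the value of [v]. *)
Lemma ignores_agree (s : seq 'I_n) (v : T -> R) (x y : T) :
    (forall i, i \in s -> ignores replace_coordinate i v) ->
    (forall i, i \notin s -> x i = y i) ->
  v x = v y.
Proof.
pose z u := foldr (fun i x => replace_coordinate i (x, y)) x u.
move=> sv xy; have vz u : {subset u <= s} -> v (z u) = v x.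
  elim: u => //= i u IH us; rewrite sv; last by apply: us; rewrite inE eqxx.
  by apply: IH => j ju; apply: us; rewrite inE ju orbT.
rewrite -(vz s)//; congr v; apply: functional_extensionality_dep => j.
have [js|/xy xyj] := boolP (j \in s).
  elim: s js {sv xy vz} => //= i s IH; rewrite inE /replace_coordinate/=.
  by case: (j == i).
elim: s {sv xy vz} => //= i s; rewrite /replace_coordinate/=.
by case: (j == i).
Qed.

(** The law of the replaced point agrees with [Q] on the pi-system of boxes. *)
Lemma product_resampling : resampling Q replace_coordinate.
Proof.
split.
- exact: measurable_replace_coordinate.
- move=> i A mA.
  pose phi := mfun_Sub (mem_set (measurable_replace_coordinate i)).
  pose QQ : probability (T * T)%type R := (Q \x Q)%E.
  apply: (@measure_unique _ R T measurable_box (fun=> setT) measurable_boxE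
    measurable_boxI _ _ (distribution QQ phi) Q) => //.
  - by move=> _; exact: measurable_boxT.
  - by apply/seteqP; split=> // x _; exists 0%N.
  - by move=> _ [B mB ->]; exact: replace_coordinate_box.
  - move=> _; apply: le_lt_trans (ltry 1).
    exact: (probability_le1 (distribution QQ phi) measurableT).
- move=> i x y z; apply: functional_extensionality_dep => j.
  by rewrite /replace_coordinate/=; case: (j == i).
- move=> i j ij x y z; apply: functional_extensionality_dep => k.
  rewrite /replace_coordinate/=; case: ifP => // /eqP ->.
  by rewrite (negbTE ij).
- move=> v iv x y.
  by apply: (@ignores_agree (enum 'I_n)) => // i; rewrite mem_enum.
Qed.

End product_resampling.

(** * Versions of conditional expectations *)

Section conditional_expectation.
Context d (Om : measurableType d) (R : realType) (P : probability Om R).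

(** The set [A] where [h' < g'] is an event of the sigma-algebra of [Y], so the
    positive function [g' - h'] has integral zero over [A] and [A] is null. *)
Lemma is_condexp_ae_unique d' (T : measurableType d') (Z : Om -> R) (Y : Om -> T)
    (g h : Om -> R) : measurable_fun setT Y ->
  is_condexp P Z Y g -> is_condexp P Z Y h -> ae_eq P setT g h.
Proof.
move=> mY.
suff le_ae (g' h' : Om -> R) : is_condexp P Z Y g' -> is_condexp P Z Y h' ->
    {ae P, forall w, g' w <= h' w}.
  move=> Yg Yh; apply: filterS2 (le_ae _ _ Yg Yh) (le_ae _ _ Yh Yg) => w gh hg _.
  by apply/eqP; rewrite eq_le gh hg.
move=> [mg ig Eg] [mh ih Eh].
pose A := [set w | h' w < g' w].
have YA : g_sigma_algebra_preimage Y A.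
  have := @measurable_fun_ltr _ (g_sigma_algebra_preimageType Y) R setT h' g' mh mg
    measurableT [set true] I.
  by rewrite setTI; congr (measurable _); apply/seteqP; split.
have mA : measurable A.
  by case: YA => B mB <-; exact: mY.
have {}ig : P.-integrable A (EFin \o g') by exact: integrableS ig.
have {}ih : P.-integrable A (EFin \o h') by exact: integrableS ih.
have D0 : (\int[P]_(w in A) (g' w - h' w)%:E = 0)%E.
  rewrite [LHS](integralB mA ig ih) Eg// -Eh// subee//.
  exact: integrable_fin_num.
have mgh : measurable_fun A (fun w => (g' w - h' w)%:E).
  exact: measurable_int (integrableB mA ig ih).
have : (\int[P]_(w in A) `|(g' w - h' w)%:E| = 0)%E.
  rewrite -[RHS]D0; apply: eq_integral => w; rewrite inE => /= hg.
  by rewrite ger0_norm// subr_ge0 ltW.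
move/(ae_eq_integral_abs _ mA mgh); apply: filterS => w /= wA.
rewrite leNgt; apply/negP => hg; have := wA hg => -[].
by move/eqP; rewrite subr_eq0 gt_eqF.
Qed.

Lemma variance_ae_eq (g h : Om -> R) : measurable_fun setT g ->
  measurable_fun setT h -> ae_eq P setT g h -> variance P g = variance P h.
Proof.
move=> mg mh gh; rewrite /variance unlock /=.
have -> : ('E_P[g] = 'E_P[h])%E.
  rewrite unlock; apply: ae_eq_integral => //; [exact/measurable_EFinP..|].
  by apply: filterS gh => w /= ->.
rewrite unlock; set m := fine _; apply: ae_eq_integral => //.
- by apply/measurable_EFinP; apply: measurable_funM; exact: measurable_funB.
- by apply/measurable_EFinP; apply: measurable_funM; exact: measurable_funB.
apply: filterS gh => w /(_ Logic.I) gh _.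
by rewrite /= !fctE /= gh.
Qed.

End conditional_expectation.

Section law.
Context d (Om : measurableType d) (R : realType) (P : probability Om R).
Context d' (T : measurableType d') (X : {RV P >-> T}).
Local Notation mu := (distribution P X).

Lemma integrable_comp_RV (u : T -> R) : mu.-integrable setT (EFin \o u) ->
  P.-integrable setT (fun w => (u (X w))%:E).
Proof.
move=> /integrableP[mv iu]; apply/integrableP; split.
  exact: (measurableT_comp mv (measurable_funP X)).
rewrite -(@ge0_integral_distribution _ _ _ _ _ P X (fun x => `|(u x)%:E|%E))//.
exact: measurableT_comp.
Qed.

Lemma integral_comp_RV (A : set T) (u : T -> R) : measurable A ->
    mu.-integrable setT (EFin \o u) ->
  (\int[P]_(w in X @^-1` A) (u (X w))%:E = \int[mu]_(x in A) (u x)%:E)%E.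
Proof.
move=> mA iu; have [mv _] := integrableP _ _ _ iu.
rewrite -(@integral_pushforward _ _ _ _ _ X _ P A (EFin \o u))//.
apply: integrableS (integrable_comp_RV iu) => //.
by rewrite -[X in measurable X]setTI; exact: measurable_funP.
Qed.

Lemma integral_comp_RVT (u : T -> R) : mu.-integrable setT (EFin \o u) ->
  (\int[P]_w (u (X w))%:E = (\int[mu]_x u x)%:E)%E.
Proof.
move=> iu; have := integral_comp_RV measurableT iu; rewrite preimage_setT => ->.
by rewrite fineK//; exact: integrable_fin_num.
Qed.

Lemma variance_comp_RV (u : T -> R) : u \in Lfun mu 2%:E ->
  variance P (u \o X) = (\int[mu]_x ((u x - \int[mu]_y u y) ^+ 2))%:E.
Proof.
move=> u2; rewrite /variance unlock; set m := \int[mu]_y u y.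
have um2 : (fun x => u x - m) \in Lfun mu 2%:E.
  by apply: Lfun2_sub => //; exact: Lfun_cst.
have -> : fine 'E_P[u \o X] = m.
  by rewrite unlock integral_comp_RVT//; exact: Lfun2_integrable.
rewrite unlock -integral_comp_RVT; last first.
  by have [_] := (square_integrableP _ _).1 um2.
by apply: eq_integral => w _; rewrite /= !fctE expr2.
Qed.

End law.

(** * Conditional expectations under a product measure *)

Section conditional_expectation_product.
Context {R : realType} {n : nat} (E : 'I_n -> completeMetricType R).
Context (sepE : forall i, separable (E i)).
Local Notation T := (borel (product_space E)).
Context (S : {set 'I_n}).
Local Notation TS := (borel (subproduct_space E S)).

(** A measurable section of the projection to the coordinates in [S]. Composing
    with it exhibits a function that ignores the other coordinates as a
    measurable function of the projection. *)
Definition extend_point (y : TS) : T := fun i =>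
  match boolP (i \in S) with
  | AltTrue iS => y (exist _ i iS)
  | AltFalse _ => point
  end.

Lemma extend_point_subproj (x : T) i : i \in S ->
  extend_point (subproj (S := S) x) i = x i.
Proof.
by move=> iS; rewrite /extend_point; case: {-}_ / boolP => //; rewrite iS.
Qed.

Lemma measurable_extend_point : measurable_fun setT extend_point.
Proof.
apply: (measurable_fun_product_space sepE) => i; rewrite /extend_point.
case: {-}_ / boolP => [iS|_]; last exact: measurable_cst.
exact: (@measurable_coordinate {i : 'I_n | i \in S} (fun i => E (val i))
  (exist _ i iS)).
Qed.

Lemma measurable_subproj :
  measurable_fun setT (fun x : T => subproj (S := S) x : TS).
Proof.
apply: (@measurable_fun_prod_topology _ (fun i : {i | i \in S} => E (val i))) => i.
  exact: (separable_second_countable (sepE (val i))).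
exact: measurable_product_coordinate.
Qed.

Lemma ignores_subproj (v : T -> R) (x : T) :
  (forall i, i \notin S -> ignores (@replace_coordinate _ _ E) i v) ->
  v (extend_point (subproj (S := S) x)) = v x.
Proof.
move=> Sv; apply: (@ignores_agree _ _ _ (enum (~: S)) v) => i;
  rewrite mem_enum inE.
  exact: Sv.
by rewrite negbK; exact: extend_point_subproj.
Qed.

Context d (Om : measurableType d) (P : probability Om R) (X : {RV P >-> T}).
Local Notation mu := (distribution P X).
Context (rs : resampling mu (@replace_coordinate _ _ E)).

(** The indicator of an event that depends on the coordinates in [S] ignores the
    others, so it can be moved out of the averages over the complement of [S];
    this gives the defining identity of the conditional expectation. *)
Lemma averages_is_condexp (f : T -> R) : f \in Lfun mu 2%:E ->
  is_condexp P (f \o X) (fun w => subproj (S := S) (X w) : TS)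
    (averages mu (@replace_coordinate _ _ E) (enum (~: S)) f \o X).
Proof.
move=> f2; set v := averages _ _ _ _.
have v2 : v \in Lfun mu 2%:E by exact: Lfun2_averages.
have Sv i : i \notin S -> ignores (@replace_coordinate _ _ E) i v.
  by move=> iS; apply: (ignores_averages rs); rewrite mem_enum inE.
split.
- have -> : v \o X = (v \o extend_point) \o (fun w => subproj (S := S) (X w) : TS).
    by apply/funext => w; rewrite /= ignores_subproj.
  have mvf : measurable_fun setT (v \o extend_point).
    exact: (measurableT_comp (Lfun2_measurable v2) measurable_extend_point).
  move=> _ B mB; exists ((v \o extend_point) @^-1` B); last by rewrite setTI.
  by rewrite -[X in measurable X]setTI; exact: mvf.
- by apply: integrable_comp_RV; exact: Lfun2_integrable.
move=> _ [B mB <-]; rewrite setTI.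
pose A := (fun x : T => subproj (S := S) x : TS) @^-1` B.
have mA : measurable A.
  by rewrite -[X in measurable X]setTI; exact: measurable_subproj.
have A2 : (\1_A : T -> R) \in Lfun mu 2%:E.
  apply/square_integrableP; split; first exact: measurable_indic.
  apply: (eq_integrable measurableT _ _ _ (integrable_indic mu mA)) => x _ /=.
  by rewrite indicE; case: (x \in A); rewrite ?expr1n ?expr0n.
have iA i : i \in enum (~: S) ->
    ignores (@replace_coordinate _ _ E) i (\1_A : T -> R).
  rewrite mem_enum inE => iS x y; rewrite !indicE.
  suff E0 : subproj (S := S) (replace_coordinate i (x, y)) = subproj x.
    suff -> : (replace_coordinate i (x, y) \in A) = (x \in A) by [].
    by apply/idP/idP; rewrite !inE /A /preimage/= E0.
  apply: functional_extensionality_dep => -[j jS].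
  rewrite /subproj /replace_coordinate /=; case: eqVneq => // ji.
  by rewrite -ji jS in iS.
have key u : u \in Lfun mu 2%:E ->
    (\int[mu]_(x in A) (u x)%:E = (\int[mu]_x (u x * \1_A x))%:E)%E.
  move=> u2; rewrite fineK; last first.
    by apply: integrable_fin_num => //; exact: Lfun2_mul_integrable.
  rewrite [LHS]integral_mkcond; apply: eq_integral => x _.
  by rewrite patchE indicE; case: ifP => _ /=; rewrite ?mulr1 ?mulr0.
transitivity (\int[mu]_(x in A) (v x)%:E)%E.
  by rewrite -(integral_comp_RV mA)//; exact: Lfun2_integrable.
transitivity (\int[mu]_(x in A) (f x)%:E)%E; last first.
  by rewrite -(integral_comp_RV mA)//; exact: Lfun2_integrable.
by rewrite !key//; congr EFin; apply: averagesM.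
Qed.

End conditional_expectation_product.

Theorem corollary3 (R : realType) (n : nat)
    (E : 'I_n -> completeMetricType R)
    (sepE : forall i, separable (E i))
    (Qi : forall i, probability (borel (E i)) R)
    (Q : probability (borel (product_space E)) R)
    (prodQ : is_product_measure Qi Q)
    (d : measure_display) (Om : measurableType d) (P : probability Om R)
    (X : {RV P >-> borel (product_space E)})
    (XQ : forall B : set (borel (product_space E)),
       measurable B -> distribution P X B = Q B)
    (C : {set {set 'I_n}})
    (f : borel (product_space E) -> R)
    (mf : measurable_fun [set: borel (product_space E)] f)
    (f2 : ('E_P[fun w => (f (X w) ^+ 2)%R] < +oo)%E)
    (condE : {set 'I_n} -> Om -> R)
    (condEP : forall S, S \in C ->
       is_condexp P (f \o X)
         (fun w => subproj (S := S) (X w) : borel (subproduct_space E S))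
         (condE S)) :
  (\sum_(S in C) variance P (condE S)
     <= (\max_(i < n) #|[set S in C | i \in S]|)%:R%:E
        * variance P (f \o X))%E.
Proof.
pose mu : probability (borel (product_space E)) R := distribution P X.
have prodmu : is_product_measure Qi mu.
  move=> A mA; rewrite -(prodQ A mA); apply: XQ.
  by apply: measurable_box_measurable; exists A.
have rs := product_resampling sepE prodmu.
have fL2 : f \in Lfun mu 2%:E.
  apply/square_integrableP; split=> //.
  have mf2 : measurable_fun setT (fun x => (f x ^+ 2)%:E).
    by apply/measurable_EFinP; exact: measurable_funX.
  apply/integrableP; split => //.
  move: f2; rewrite unlock; apply: le_lt_trans.
  rewrite [leLHS](@ge0_integral_distribution _ _ _ _ _ P X
    (fun x => `|(f x ^+ 2)%:E|%E))//.
    rewrite le_eqVlt; apply/orP; left; apply/eqP; apply: eq_integral => w _ /=.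
    by rewrite ger0_norm// sqr_ge0.
  exact: measurableT_comp.
pose v (S : {set 'I_n}) :=
  averages mu (@replace_coordinate _ _ E) (enum (~: S)) f.
have v2 S : v S \in Lfun mu 2%:E by exact: Lfun2_averages.
(* any version of the conditional expectation has the variance of the average *)
have varE S : S \in C ->
    variance P (condE S) = (\int[mu]_x ((v S x - \int[mu]_y f y) ^+ 2))%:E.
  move=> SC; rewrite -(integral_averages rs (enum (~: S)) fL2).
  have vS := averages_is_condexp sepE S rs fL2.
  rewrite -(variance_comp_RV (v2 S)); apply: variance_ae_eq.
  - by have [_ /integrableP[/measurable_EFinP]] := condEP S SC.
  - exact: (measurableT_comp (Lfun2_measurable (v2 S)) (measurable_funP X)).
  apply: is_condexp_ae_unique (condEP S SC) vS.
  exact: (measurableT_comp (@measurable_subproj _ _ _ sepE S) (measurable_funP X)).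
rewrite (eq_bigr _ varE) sumEFin (variance_comp_RV fL2) -EFinM lee_fin.
apply: (sum_variance_averages_le rs) => // i.
exact: (@leq_bigmax _ (fun i : 'I_n => #|[set S in C | i \in S]|)).
Qed.
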